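(* For any integer $k>1$, $$\mathrm{mincol}_{2k+1}\,T(2,2k+1)\le k+2 .$$
   Context: Let $r>1$ be an integer, and let $D$ be a diagram of a knot or link $K$. An $r$-coloring (Fox coloring) of $D$ is an assignment of an element of $\mathbb{Z}_r=\mathbb{Z}/r\mathbb{Z}$ (a color) to each arc of $D$ such that at each crossing the sum of the colors of the two under-arcs minus twice the color of the over-arc is $0$ mod $r$. It is trivial if all arcs receive the same color, and non-trivial otherwise. Whether $D$ admits a non-trivial $r$-coloring does not depend on the diagram $D$ of $K$. If $K$ admits non-trivial $r$-colorings, then for a diagram $D$ of $K$ let $n_{r,K}(D)$ be the minimum number of distinct colors used by a non-trivial $r$-coloring of $D$, and set $\mathrm{mincol}_r K:=\min\{n_{r,K}(D) : D \text{ is a diagram of } K\}$. $T(2,n)$ is the torus link obtained as the closure of the two-strand braid $\sigma_1^n$, $\sigma_1\in B_2$. *)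

(* Defs.v *)
From HB Require Import structures.
From Stdlib Require Import Relation_Operators.
From mathcomp Require Import all_boot all_algebra.

Set Implicit Arguments.
Unset Strict Implicit.
Unset Printing Implicit Defensive.

Import GRing.Theory.

(* Unoriented link diagrams in sliced (Morse) form.  Every link diagram in the
   plane is planar isotopic to one in which each horizontal slice contains a
   single local minimum (Cup), local maximum (Cap) or crossing (Cross), all
   other strands being vertical; the diagram is then the list of its slices,
   read from bottom to top.  Strands are numbered from the left, from 0.
   A tile (k, i) has exactly i vertical strands to the left of its feature.
   In a crossing of strands i and i.+1, Cross true means that the over-strand
   goes from bottom left to top right, Cross false that it goes from bottom
   right to top left. *)
Inductive kind := Cup | Cap | Cross of bool.

Definition dom (k : kind) : nat := if k is Cup then 0 else 2.
Definition cod (k : kind) : nat := if k is Cap then 0 else 2.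

Definition tile : Type := kind * nat.

(* Number of strands above a slice, given the number n of strands below it;
   None when the slice does not fit on n strands. *)
Definition next (n : nat) (t : tile) : option nat :=
  if t.2 + dom t.1 <= n then Some (n - dom t.1 + cod t.1) else None.

Definition run (n : nat) (w : seq tile) : option nat :=
  foldl (fun o t => obind (fun m => next m t) o) (Some n) w.

Record diagram := Diagram {
  tiles :> seq tile;
  tiles_closed : run 0 tiles == Some 0
}.
HB.instance Definition _ := [isSub for tiles].

(* Planar isotopy and Reidemeister moves for sliced diagrams (the Turaev moves
   for unoriented diagrams).  Each is applied locally, on consecutive slices. *)
Inductive move : seq tile -> seq tile -> Prop :=
| Exchange k1 k2 i d :
    move [:: (k1, i); (k2, i + cod k1 + d)]
         [:: (k2, i + dom k1 + d); (k1, i)]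
| ZigzagL i : move [:: (Cup, i); (Cap, i.+1)] [::]
| ZigzagR i : move [:: (Cup, i.+1); (Cap, i)] [::]
(* a strand passing over or under a maximum or a minimum *)
| SlideCap b i :
    move [:: (Cross b, i); (Cap, i.+1)] [:: (Cross (~~ b), i.+1); (Cap, i)]
| SlideCup b i :
    move [:: (Cup, i.+1); (Cross b, i)] [:: (Cup, i); (Cross (~~ b), i.+1)]
| Reidemeister1Cap b i : move [:: (Cross b, i); (Cap, i)] [:: (Cap, i)]
| Reidemeister1Cup b i : move [:: (Cup, i); (Cross b, i)] [:: (Cup, i)]
| Reidemeister2 b i : move [:: (Cross b, i); (Cross (~~ b), i)] [::]
| Reidemeister3 b i :
    move [:: (Cross b, i); (Cross b, i.+1); (Cross b, i)]
         [:: (Cross b, i.+1); (Cross b, i); (Cross b, i.+1)].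

(* Both ends are closed diagrams, so that both sides of the move fit on the
   strands available at that height. *)
Definition isotopy_step (D E : diagram) : Prop :=
  exists u v s t : seq tile,
    [/\ move s t, tiles D = u ++ s ++ v & tiles E = u ++ t ++ v].

(* D and E represent the same link. *)
Definition isotopic : diagram -> diagram -> Prop :=
  clos_refl_sym_trans diagram isotopy_step.

(* A point (l, p) of a diagram is the place where strand p crosses the
   horizontal line just below slice l (above the last slice if l = size D).
   Every arc goes through such points. *)
Definition point : Type := nat * nat.

Definition width (D : diagram) (l : nat) : nat :=
  odflt 0 (run 0 (take l D)).

Definition points (D : diagram) : seq point :=
  [seq (l, p) | l <- iota 0 (size D).+1, p <- iota 0 (width D l)].

(* The four ends of a crossing Cross b at position i in slice l; here b and
   ~~ b are read as 0 or 1. *)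
Definition over_bot (b : bool) (l i : nat) : point := (l, i + ~~ b).
Definition over_top (b : bool) (l i : nat) : point := (l.+1, i + b).
Definition under_bot (b : bool) (l i : nat) : point := (l, i + b).
Definition under_top (b : bool) (l i : nat) : point := (l.+1, i + ~~ b).

(* Points joined, within one slice or along its boundary, by a piece of strand
   that does not pass under a crossing. *)
Inductive joined (D : diagram) : point -> point -> Prop :=
| JoinLeft l k i p : onth D l = Some (k, i) -> p < i ->
    joined D (l, p) (l.+1, p)
| JoinRight l k i p : onth D l = Some (k, i) -> i + dom k + p < width D l ->
    joined D (l, i + dom k + p) (l.+1, i + cod k + p)
| JoinCup l i : onth D l = Some (Cup, i) -> joined D (l.+1, i) (l.+1, i.+1)
| JoinCap l i : onth D l = Some (Cap, i) -> joined D (l, i) (l, i.+1)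
| JoinOver l b i : onth D l = Some (Cross b, i) ->
    joined D (over_bot b l i) (over_top b l i).

Definition same_arc (D : diagram) : point -> point -> Prop :=
  clos_refl_sym_trans point (joined D).

(* Fox colorings: colorings of the arcs, given as functions of points that are
   constant on arcs.  'Z_r is Z/rZ only for r > 1.  Values of c outside of
   points D are irrelevant. *)
Definition coloring (r : nat) (D : diagram) (c : point -> 'Z_r) : Prop :=
  (forall x y, same_arc D x y -> c x = c y) /\
  (forall l b i, onth D l = Some (Cross b, i) ->
     c (under_bot b l i) + c (under_top b l i) - c (over_bot b l i) *+ 2 = 0)%R.

Definition nontrivial (r : nat) (D : diagram) (c : point -> 'Z_r) : Prop :=
  exists x y, [/\ x \in points D, y \in points D & c x != c y].

Definition ncolors (r : nat) (D : diagram) (c : point -> 'Z_r) : nat :=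
  size (undup [seq c x | x <- points D]).

Definition is_min (P : nat -> Prop) (m : nat) : Prop :=
  P m /\ forall j, P j -> m <= j.

(* diagram_mincol r D m: D has non-trivial r-colorings, and the minimum number
   of colors they use is m. *)
Definition diagram_mincol (r : nat) (D : diagram) : nat -> Prop :=
  is_min (fun j => exists c : point -> 'Z_r,
    [/\ coloring D c, nontrivial D c & ncolors D c = j]).

(* link_mincol r K m: the link K represented by a diagram has non-trivial
   r-colorings, and mincol_r K = m. *)
Definition link_mincol (r : nat) (K : diagram) : nat -> Prop :=
  is_min (fun j => exists D : diagram, isotopic D K /\ diagram_mincol r D j).

(* The closure of the braid sigma_1 ^ n on strands 0 and 1; the closing strands
   are 2 and 3. *)
Definition torus2_tiles (n : nat) : seq tile :=
  [:: (Cup, 0); (Cup, 1)] ++ nseq n (Cross true, 0) ++ [:: (Cap, 1); (Cap, 0)].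

Lemma torus2_closed n : run 0 (torus2_tiles n) == Some 0.
Proof.
by rewrite /torus2_tiles /run !foldl_cat /=; elim: n.
Qed.

Definition torus2 (n : nat) : diagram := Diagram (torus2_closed n).

(* Main.v *)
Require Import Defs.
From mathcomp Require Import all_boot.
From Stdlib Require Import Relation_Operators Classical.
From mathcomp Require Import all_algebra zify.

Set Implicit Arguments.
Unset Strict Implicit.
Unset Printing Implicit Defensive.

Import GRing.Theory.

(** In the standard diagram of T(2, 2k+1), the over-arc that crosses over at the
    last crossing runs through the inner closing strand down to the first
    crossing.  Keeping its ends fixed, pull it over the last k of the other 2k
    crossings: it now runs down the left of the braid and crosses it once
    halfway.  When this arc has color 0, every color x that it sweeps over
    becomes -x, so that the colors k, ..., 2k+1 of the upper half are folded
    back onto k+1, ..., 0, and only 0, ..., k+1 remain. *)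

(** Strong induction, with excluded middle telling whether a smaller value satisfies [P]. It serves
    for both minima, over colorings and over diagrams, so that one coloring of one diagram
    suffices. *)
Lemma is_min_exists (P : nat -> Prop) j :
  P j -> exists m, is_min P m /\ m <= j.
Proof.
elim/ltn_ind: j => j IHj Pj.
have [[i [Pi lt_ij]]|noP] := classic (exists i, P i /\ i < j).
  have [m [minm le_mi]] := IHj i lt_ij Pi.
  by exists m; split=> //; apply: leq_trans le_mi (ltnW lt_ij).
exists j; split=> //; split=> // i Pi.
by rewrite leqNgt; apply/negP => lt_ij; apply: noP; exists i.
Qed.

(** * Moves on open tangles *)

Lemma run_cat n s t : run n (s ++ t) = obind (fun m => run m t) (run n s).
Proof.
rewrite /run foldl_cat; case: (foldl _ _ s) => //=.
by elim: t.
Qed.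

(** Words need not be closed here, so moves can be chained on a piece of a diagram with [n] strands
    entering from below. Equality of [run] lets the piece be put back. *)
Definition tangle_step (n : nat) (s t : seq tile) : Prop :=
  exists u v s' t' : seq tile,
    [/\ move s' t', s = u ++ s' ++ v, t = u ++ t' ++ v & run n s = run n t].

Definition tangle_eq (n : nat) : seq tile -> seq tile -> Prop :=
  clos_refl_sym_trans (seq tile) (tangle_step n).

Lemma tangle_eq_move n s t : move s t -> run n s = run n t -> tangle_eq n s t.
Proof.
move=> mst eq_run; apply: rst_step; exists [::], [::], s, t.
by rewrite /= !cats0.
Qed.

Lemma tangle_eq_run n s t : tangle_eq n s t -> run n s = run n t.
Proof.
by elim=> {s t} [s t [u [v [s' [t' [_ _ _ ->]]]]]|s|s t _ ->|s t w _ -> _ ->].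
Qed.

Lemma tangle_eq_cat m n u v s t :
  run m u = Some n -> tangle_eq n s t -> tangle_eq m (u ++ s ++ v) (u ++ t ++ v).
Proof.
move=> run_u; elim=> {s t} [s t|s|s t _|s t w _ IHst _].
- case=> a [b [s' [t' [mst -> -> eq_run]]]]; apply: rst_step.
  exists (u ++ a), (b ++ v), s', t'; split; rewrite -?catA // 2!(catA a).
  by rewrite !(catA (a ++ _)) !(run_cat _ u) run_u /= !(run_cat _ _ v) -!catA eq_run.
- exact: rst_refl.
- exact: rst_sym.
- exact: rst_trans.
Qed.

(** All words along a chain of [tangle_eq] have the same [run]; the intermediate ones are therefore
    closed diagrams too, as transitivity requires. *)
Lemma tangle_eq_isotopic (D E : diagram) : tangle_eq 0 D E -> isotopic D E.
Proof.
move: {-1}(tiles D) (erefl (tiles D)) {-1}(tiles E) (erefl (tiles E)).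
move=> s Ds t Et eq_st; elim: eq_st D E Ds Et => {s t}.
- move=> s t [u [v [s' [t' [mst Es Et _]]]]] D E Ds Et'.
  by apply: rst_step; exists u, v, s', t'; rewrite Ds Et'.
- by move=> s D E Ds Es; rewrite (val_inj (etrans Ds (esym Es))); apply: rst_refl.
- by move=> s t _ IH D E Ds Et; apply/rst_sym/IH.
move=> s t w st IHst _ IHtw D E Ds Ew.
have ct : run 0 t == Some 0 by rewrite -(tangle_eq_run st) -Ds tiles_closed.
by apply: (@rst_trans _ _ _ (Diagram ct)); [apply: IHst|apply: IHtw].
Qed.

(** * Pulling the over-arc across the braid *)

Notation sigma i := (Cross true, i).
Notation sigmaV i := (Cross false, i).

Lemma run_nseq_cross n m b i :
  i.+1 < n -> run n (nseq m (Cross b, i)) = Some n.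
Proof.
move=> lt_in; elim: m => // m IHm.
have run1 : run n [:: (Cross b, i)] = Some n.
  by rewrite /run /= /Defs.next /= addn2 lt_in subnK //; lia.
by rewrite -add1n nseqD run_cat [run n _]run1.
Qed.

(** This is the braid relation [Reidemeister3 true 0] multiplied on both sides by [T], the inverse
    of [[:: sigma 0; sigma 1]]; cancelling pairs are inserted and removed by [Reidemeister2]. *)
Lemma strand_over_crossing :
  tangle_eq 4 [:: sigma 0; sigmaV 1; sigmaV 0] [:: sigmaV 1; sigmaV 0; sigma 1].
Proof.
pose T := [:: sigmaV 1; sigmaV 0].
have R2 b i u v s : i < 3 -> run 4 u = Some 4 ->
    s = u ++ [:: (Cross b, i); (Cross (~~ b), i)] ++ v ->
    tangle_eq 4 s (u ++ v).
  move=> lt_i3 run_u ->; apply: (@tangle_eq_cat _ 4 _ _ _ [::]) => //.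
  apply: tangle_eq_move (Reidemeister2 b i) _.
  by case: i lt_i3 => [|[|[]]].
apply: (@rst_trans _ _ _ ([:: sigmaV 1; sigma 1; sigma 0] ++ T)).
  by apply: rst_sym; apply: (@R2 false 1 [::]).
apply: (@rst_trans _ _ _ (T ++ [:: sigma 0; sigma 1; sigma 0] ++ T)).
  by apply: rst_sym; apply: (@R2 false 0 [:: sigmaV 1] (sigma 1 :: sigma 0 :: T)).
apply: (@rst_trans _ _ _ (T ++ [:: sigma 1; sigma 0; sigma 1] ++ T)).
  apply: (@tangle_eq_cat _ 4) => //.
  exact: tangle_eq_move (Reidemeister3 true 0) _.
apply: (@rst_trans _ _ _ (T ++ [:: sigma 1; sigma 0; sigmaV 0])).
  exact: (@R2 true 1 (T ++ [:: sigma 1; sigma 0]) [:: sigmaV 0]).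
by apply: (@R2 true 0 (T ++ [:: sigma 1]) [::]).
Qed.

Lemma strand_over_crossings m :
  tangle_eq 4 (nseq m (sigma 0) ++ [:: sigmaV 1; sigmaV 0])
              ([:: sigmaV 1; sigmaV 0] ++ nseq m (sigma 1)).
Proof.
elim: m => [|m IHm]; first exact: rst_refl.
have := @tangle_eq_cat 4 4 [:: sigma 0] [::] _ _ erefl IHm.
rewrite !cats0 => step; apply: rst_trans step _.
exact: (@tangle_eq_cat 4 4 [::] (nseq m (sigma 1)) _ _ erefl strand_over_crossing).
Qed.

(** The two middle crossings carry the over-arc from strand 2 to strand 0, so the braid occupies
    strands 0 and 1 below them, 1 and 2 above. *)
Definition folded_tiles (k : nat) : seq tile :=
  [:: (Cup, 0); (Cup, 1)] ++ nseq k (sigma 0) ++ [:: sigmaV 1; sigmaV 0]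
    ++ nseq k (sigma 1) ++ [:: (Cap, 0); (Cap, 0)].

Lemma folded_closed k : run 0 (folded_tiles k) == Some 0.
Proof.
have runS m n s t : run m s = Some n -> run m (s ++ t) = run n t.
  by rewrite run_cat => ->.
by rewrite /folded_tiles (runS _ 4) // (runS _ 4) ?run_nseq_cross // (runS _ 4) //
  (runS _ 4) ?run_nseq_cross.
Qed.

Definition folded (k : nat) : diagram := Diagram (folded_closed k).

Lemma folded_isotopic k : isotopic (folded k) (torus2 (2 * k + 1)).
Proof.
apply: tangle_eq_isotopic; apply: rst_sym => /=.
pose U := [:: (Cup, 0); (Cup, 1)] ++ nseq k (sigma 0).
have runU : run 0 U = Some 4 by rewrite run_cat /= run_nseq_cross.
pose V := U ++ nseq k (sigma 0).
have runV : run 0 V = Some 4 by rewrite run_cat runU /= run_nseq_cross.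
have -> : torus2_tiles (2 * k + 1) = V ++ [:: sigma 0; (Cap, 1)] ++ [:: (Cap, 0)].
  rewrite /torus2_tiles /V /U mul2n -addnn !nseqD -!catA //.
(* The last crossing, slid around the maximum, becomes a passage of the inner closing strand over
   one braid strand; the kink added next supplies the second passage. *)
apply: (@rst_trans _ _ _ (V ++ [:: sigmaV 1; (Cap, 0)] ++ [:: (Cap, 0)])).
  apply: tangle_eq_cat runV _.
  exact: tangle_eq_move (SlideCap true 0) _.
apply: (@rst_trans _ _ _
    ((V ++ [:: sigmaV 1]) ++ [:: sigmaV 0; (Cap, 0)] ++ [:: (Cap, 0)])).
  rewrite -(cat1s (sigmaV 1)) -catA (catA V); apply: rst_sym.
  apply: (@tangle_eq_cat _ 4); first by rewrite run_cat runV.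
  exact: tangle_eq_move (Reidemeister1Cap false 0) _.
(* The over-arc now crosses above all 2k remaining crossings and slides down past the upper k. *)
have := tangle_eq_cat [:: (Cap, 0); (Cap, 0)] runU (strand_over_crossings k).
by rewrite /folded_tiles /V /U -!catA.
Qed.

(** * The coloring of the folded diagram *)

(* The default value 1 of nth is the color of the outer closing strand, at
   position 3; it also makes the colors constant beyond the width. *)
Definition fold_color (k l p : nat) : nat :=
  if (l <= 1) || (2 * k + 5 <= l) then 1
  else if l <= k + 2 then nth 1 [:: l - 1; l - 2; 0] p
  else if l == k + 3 then nth 1 [:: k + 1; 0; k + 1] p
  else nth 1 [:: 0; 2 * k + 4 - l; 2 * k + 5 - l] p.

Definition fold_coloring (k : nat) (x : point) : 'Z_(2 * k + 1) :=
  ((fold_color k x.1 x.2)%:R)%R.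

Variant folded_tile_spec (k l : nat) : tile -> Type :=
| FoldedCup0 of l = 0 : folded_tile_spec k l (Cup, 0)
| FoldedCup1 of l = 1 : folded_tile_spec k l (Cup, 1)
| FoldedLower of 2 <= l < k + 2 : folded_tile_spec k l (sigma 0)
| FoldedOver1 of l = k + 2 : folded_tile_spec k l (sigmaV 1)
| FoldedOver0 of l = k + 3 : folded_tile_spec k l (sigmaV 0)
| FoldedUpper of k + 4 <= l < 2 * k + 4 : folded_tile_spec k l (sigma 1)
| FoldedCap of 2 * k + 4 <= l < 2 * k + 6 : folded_tile_spec k l (Cap, 0).

Lemma folded_tileP k l t : onth (folded k) l = Some t -> folded_tile_spec k l t.
Proof.
rewrite /= /folded_tiles; case: l => [|[|l]] /=.
- by case=> <-; constructor.
- by case=> <-; constructor.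
rewrite onth_cat size_nseq onth_nseq; case: ltnP => [lt_lk|le_kl].
  by case=> <-; constructor; lia.
case E: (l - k) => [|[|j]] /=.
- by case=> <-; constructor; lia.
- by case=> <-; constructor; lia.
rewrite onth_cat size_nseq onth_nseq; case: ltnP => [lt_jk|le_kj].
  by case=> <-; constructor; lia.
case E': (j - k) => [|[|i]] //=.
- by case=> <-; constructor; lia.
- by case=> <-; constructor; lia.
by rewrite onth0n.
Qed.

(** One constructor per linear formula, so that case analysis leaves only goals for [lia]. *)
Variant fold_color_spec (k l p : nat) : nat -> Type :=
| FoldedOuter of (l <= 1) || (2 * k + 5 <= l) || (3 <= p) : fold_color_spec k l p 1
| FoldedLower0 of 2 <= l <= k + 2 & p = 0 : fold_color_spec k l p (l - 1)
| FoldedLower1 of 2 <= l <= k + 2 & p = 1 : fold_color_spec k l p (l - 2)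
| FoldedLower2 of 2 <= l <= k + 2 & p = 2 : fold_color_spec k l p 0
| FoldedMiddle0 of l = k + 3 & p = 0 : fold_color_spec k l p (k + 1)
| FoldedMiddle1 of l = k + 3 & p = 1 : fold_color_spec k l p 0
| FoldedMiddle2 of l = k + 3 & p = 2 : fold_color_spec k l p (k + 1)
| FoldedUpper0 of k + 4 <= l < 2 * k + 5 & p = 0 : fold_color_spec k l p 0
| FoldedUpper1 of k + 4 <= l < 2 * k + 5 & p = 1 :
    fold_color_spec k l p (2 * k + 4 - l)
| FoldedUpper2 of k + 4 <= l < 2 * k + 5 & p = 2 :
    fold_color_spec k l p (2 * k + 5 - l).

Lemma fold_colorP k l p : fold_color_spec k l p (fold_color k l p).
Proof.
rewrite /fold_color; case: ifP => [?|?]; first by constructor; lia.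
case: ifP => [?|?]; last case: ifP => [?|?].
all: case: p => [|[|[|p]]] /=; rewrite ?nth_nil; constructor; lia.
Qed.

Lemma fold_color_le k l p : fold_color k l p <= k + 1.
Proof. by case: fold_colorP; lia. Qed.

Lemma fold_color_joined k x y :
  joined (folded k) x y -> fold_color k x.1 x.2 = fold_color k y.1 y.2.
Proof.
case=> {x y} [l t i p|l t i p|l i|l i|l b i] /folded_tileP.
all: move E: (_, i) => w tileP; case: tileP E => ? [] //= *; subst => /=.
all: by case: fold_colorP => ? //; case: fold_colorP; lia.
Qed.

(** In each half the colors at a crossing are consecutive integers with the over-color in the
    middle, which gives the first alternative. The second comes from the two middle crossings: the
    over-arc has color 0 and the under-colors are k and k+1. *)
Lemma fold_color_cross k l b i :
  onth (folded k) l = Some (Cross b, i) ->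
  let c x := fold_color k x.1 x.2 in
  let d := c (under_bot b l i) + c (under_top b l i) in
  d = 2 * c (over_bot b l i) \/ d = 2 * c (over_bot b l i) + (2 * k + 1).
Proof.
move/folded_tileP; move E: (_, i) => w tileP; case: tileP E => ? [] //= *; subst.
all: rewrite /=; case: fold_colorP => ? //; case: fold_colorP => ? //.
all: by case: fold_colorP; lia.
Qed.

Lemma fold_coloringP k : 0 < k -> coloring (folded k) (@fold_coloring k).
Proof.
move=> k_gt0; split=> [x y|l b i].
  elim=> {x y} [x y /fold_color_joined|//|//|x y z _ -> _ ->//].
  by rewrite /fold_coloring => ->.
move/fold_color_cross => /= eq_c; apply/eqP.
rewrite /fold_coloring subr_eq0 -natrD -mulrnA (mulnC _ 2).
case: eq_c => ->; first exact: eqxx.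
by rewrite natrD pchar_Zp ?addr0 //; lia.
Qed.

Lemma fold_coloring_nontrivial k : 0 < k -> nontrivial (folded k) (@fold_coloring k).
Proof.
move=> k_gt0; exists (2, 0), (2, 1).
have pts p : p < 4 -> (2, p) \in points (folded k).
  move=> lt_p4; apply/allpairsPdep; exists 2, p.
  by rewrite !mem_iota /width /= !take0.
split; try exact: pts.
rewrite /fold_coloring /=.
have -> : fold_color k 2 0 = 1 by case: fold_colorP; lia.
have -> : fold_color k 2 1 = 0 by case: fold_colorP; lia.
exact: oner_neq0.
Qed.

Lemma fold_ncolors k : ncolors (folded k) (@fold_coloring k) <= k + 2.
Proof.
rewrite /ncolors -[leqRHS](size_iota 0) -(size_map (fun j => j%:R%R : 'Z_(2 * k + 1))).
apply: uniq_leq_size; first exact: undup_uniq.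
move=> c; rewrite mem_undup => /mapP[x _ ->]; apply: map_f.
by rewrite mem_iota add0n addn2 ltnS -addn1 fold_color_le.
Qed.

Theorem proposition3p3 (k : nat) (hk : 1 < k) :
  exists m : nat,
    link_mincol (2 * k + 1) (torus2 (2 * k + 1)) m /\ m <= k + 2.
Proof.
have k_gt0 : 0 < k by apply: ltnW.
pose uses j := exists c : point -> 'Z_(2 * k + 1),
  [/\ coloring (folded k) c, nontrivial (folded k) c & ncolors (folded k) c = j].
have uses_fold : uses (ncolors (folded k) (@fold_coloring k)).
  exists (@fold_coloring k); split=> //; first exact: fold_coloringP.
  exact: fold_coloring_nontrivial.
have [j [min_j le_j]] := is_min_exists uses_fold.
pose attained i := exists D : diagram,
  isotopic D (torus2 (2 * k + 1)) /\ diagram_mincol (2 * k + 1) D i.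
have attained_j : attained j.
  by exists (folded k); split=> //; apply: folded_isotopic.
(* The minimum [j] for the folded diagram is one candidate in the minimum over all diagrams. *)
have [m [min_m le_m]] := is_min_exists attained_j.
exists m; split=> //.
exact: leq_trans le_m (leq_trans le_j (fold_ncolors k)).
Qed.
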